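(* Let $\{\mathsf{K}_t\}_{t=1}^\infty\subset \mathcal{C}_{n,0}$ be a sequence of policies that converges to a boundary point $\mathsf{K}_\infty=\begin{bmatrix}0 & C_{\mathsf{K}_\infty}\\ B_{\mathsf{K}_\infty} & A_{\mathsf{K}_\infty}\end{bmatrix}\in\partial\mathcal{C}_{n,0}$. Suppose $\mathsf{K}_\infty$ corresponds to a minimal policy, i.e., $(A_{\mathsf{K}_\infty},B_{\mathsf{K}_\infty})$ is controllable and $(C_{\mathsf{K}_\infty},A_{\mathsf{K}_\infty})$ is observable. Then $\lim_{t\to\infty}J_{\mathtt{LQG},n}(\mathsf{K}_t)=\infty$.
   Context: Plant data: integers $n,m,p\ge 1$, real matrices $A\in\mathbb{R}^{n\times n}$, $B\in\mathbb{R}^{n\times m}$, $C\in\mathbb{R}^{p\times n}$, and symmetric weights $Q\succeq 0$, $W\succeq 0$ ($n\times n$), $R\succ 0$ ($m\times m$), $V\succ 0$ ($p\times p$); $M^{1/2}$ is the symmetric positive semidefinite square root. Standing assumptions: $(A,B)$ and $(A,W^{1/2})$ are controllable, $(C,A)$ and $(Q^{1/2},A)$ are observable. A square matrix is stable if all its eigenvalues have strictly negative real parts. A strictly proper dynamic policy of order $n$ is a matrix $\mathsf{K}=\begin{bmatrix}0 & C_{\mathsf K}\\ B_{\mathsf K} & A_{\mathsf K}\end{bmatrix}$ with $A_{\mathsf K}\in\mathbb{R}^{n\times n}$, $B_{\mathsf K}\in\mathbb{R}^{n\times p}$, $C_{\mathsf K}\in\mathbb{R}^{m\times n}$ and zero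 $m\times p$ upper-left block; $\mathcal{V}_n$ is the vector space of all such matrices. Define $$A_{\mathrm{cl}}(\mathsf K)=\begin{bmatrix}A & BC_{\mathsf K}\\ B_{\mathsf K}C & A_{\mathsf K}\end{bmatrix},\quad B_{\mathrm{cl}}(\mathsf K)=\begin{bmatrix}W^{1/2}&0\\0&B_{\mathsf K}V^{1/2}\end{bmatrix},\quad C_{\mathrm{cl}}(\mathsf K)=\begin{bmatrix}Q^{1/2}&0\\0&R^{1/2}C_{\mathsf K}\end{bmatrix}.$$ $\mathcal{C}_{n,0}=\{\mathsf K\in\mathcal{V}_n: A_{\mathrm{cl}}(\mathsf K)\text{ is stable}\}$, an open subset of $\mathcal{V}_n$; $\partial\mathcal{C}_{n,0}$ is its boundary in $\mathcal{V}_n$. The LQG cost is $J_{\mathtt{LQG},n}(\mathsf K)=\|\mathbf{T}(\mathsf K,\cdot)\|_{\mathcal{H}_2}$ for $\mathsf K\in\mathcal{C}_{n,0}$, where $\mathbf{T}(\mathsf K,s)=C_{\mathrm{cl}}(\mathsf K)(sI-A_{\mathrm{cl}}(\mathsf K))^{-1}B_{\mathrm{cl}}(\mathsf K)$ and $\|\mathbf{T}\|_{\mathcal{H}_2}^2=\frac{1}{2\pi}\int_{-\infty}^{\infty}\operatorname{tr}(\mathbf{T}(j\omega)^{\mathsf H}\mathbf{T}(j\omega))\,d\omega$. *)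

(* Defs.v *)
From HB Require Import structures.
From mathcomp Require Import all_boot all_order all_algebra.
From mathcomp Require Import sesquilinear spectral complex.
From mathcomp Require Import all_classical all_reals all_analysis.
Set Implicit Arguments.
Unset Strict Implicit.
Unset Printing Implicit Defensive.
Import Order.TTheory GRing.Theory Num.Theory.
Import numFieldNormedType.Exports.

Local Open Scope classical_set_scope.
Local Open Scope complex_scope.
Local Open Scope sesquilinear_scope.
Local Open Scope ring_scope.

Section LinearAlgebra.
Variable R : realType.

Definition psd n (M : 'M[R]_n) : Prop :=
  M^T = M /\ forall x : 'cV[R]_n, 0 <= (x^T *m M *m x) 0 0.

Definition pd n (M : 'M[R]_n) : Prop :=
  M^T = M /\ forall x : 'cV[R]_n, x != 0 -> 0 < (x^T *m M *m x) 0 0.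

Definition cmx m n (M : 'M[R]_(m, n)) : 'M[R[i]]_(m, n) :=
  map_mx (real_complex R) M.

(* The default value 0 is only reached when M has no positive semidefinite
   square root; this does not happen for psd M, see psd_sqrtmxP. *)
Definition sqrtmx n (M : 'M[R]_n) : 'M[R]_n :=
  xget 0 [set S : 'M[R]_n | psd S /\ S *m S = M].

Lemma interpolation (F : fieldType) (f : F -> F) (s : seq F) :
  exists p : {poly F}, {in s, forall x, p.[x] = f x}.
Proof.
elim: s => [|a s [p ps]]; first by exists 0.
have [as_|as_] := boolP (a \in s).
  by exists p => x; rewrite inE => /predU1P[->|]; exact: ps.
pose q : {poly F} := \prod_(y <- s) ('X - y%:P).
have qa : q.[a] != 0 by rewrite -/(root q a) root_prod_XsubC.
exists (p + ((f a - p.[a]) / q.[a]) *: q) => x.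
rewrite inE hornerD hornerZ => /predU1P[->|xs].
  by rewrite divfK// addrC subrK.
have /eqP -> : q.[x] == 0 by rewrite -/(root q x) root_prod_XsubC.
by rewrite mulr0 addr0 ps.
Qed.

Lemma psd_eigenvalue_ge0 n (M : 'M[R]_n) (d : R) :
  psd M -> eigenvalue M d -> 0 <= d.
Proof.
move=> [_ Mge0] /eigenvalueP[v vM v0].
have := Mge0 v^T; rewrite trmxK vM -scalemxAl mxE pmulr_lge0// mxE.
under eq_bigr do rewrite mxE -expr2.
rewrite lt_neqAle sumr_ge0 ?andbT => [|i _]; last exact: sqr_ge0.
apply: contra_neq v0 => /esym/eqP.
rewrite psumr_eq0 => [/allP v0|i _]; last exact: sqr_ge0.
apply/rowP => i; rewrite mxE; apply/eqP; rewrite -sqrf_eq0.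
exact: (v0 i (mem_index_enum i)).
Qed.

Lemma psd_sqrt_ex n (M : 'M[R]_n) :
  psd M -> exists S : 'M[R]_n, psd S /\ S *m S = M.
Proof.
case: n M => [|n] M Mpsd; first by exists M; split=> //; apply/matrixP=> -[].
have [Msym _] := Mpsd.
pose D := spectral_diag (cmx M); pose P := spectralmx (cmx M).
have CMh : cmx M \is hermsymmx.
  apply/is_hermitianmxP; rewrite expr0 scale1r.
  apply/matrixP => i j; rewrite !mxE -[in LHS]Msym mxE.
  by apply/esym/eqP; rewrite eq_complex/= oppr0 !eqxx.
have CME : cmx M = invmx P *m diag_mx D *m P.
  exact/orthomx_spectralP/hermitian_normalmx.
have Punit : P \in unitmx := spectral_unit _.
pose d i : R := complex.Re (D 0 i).
have DE i : D 0 i = (d i)%:C.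
  have /mxOverP/(_ 0 i) := hermitian_spectral_diag_real CMh.
  by rewrite -/D /d; case: (D 0 i) => a b; rewrite complex_real => /= /eqP->.
have d_ge0 i : 0 <= d i.
  apply: (psd_eigenvalue_ge0 Mpsd).
  rewrite eigenvalue_root_char -(fmorph_root (real_complex R)) map_char_poly.
  rewrite -/(cmx M) -eigenvalue_root_char.
  apply/eigenvalueP; exists (row i P); last first.
    by apply: contraTneq Punit => Pi0; rewrite -row_free_unit;
       apply/row_freePn; exists i; rewrite Pi0 sub0mx.
  rewrite -row_mul CME !mulmxA mulmxV// mul1mx row_mul row_diag_mx.
  by rewrite -scalemxAl -rowE DE.
have [q qP] := interpolation (fun x => Num.sqrt (Num.sqrt x))
  [seq d i | i <- enum 'I_n.+1].
have qd i : q.[d i] ^+ 4 = d i.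
  rewrite qP ?map_f ?mem_enum// -[4%N]/(2 * 2)%N exprM.
  by rewrite !sqr_sqrtr ?sqrtr_ge0.
pose T := horner_mx M q.
have Tsym : T^T = T.
  rewrite /T; elim/poly_ind: (q) => [|r c IHr]; first by rewrite rmorph0 trmx0.
  rewrite rmorphD rmorphM/= horner_mx_X horner_mx_C linearD/= tr_scalar_mx.
  rewrite -mulmxE trmx_mul IHr Msym; congr (_ + _).
  exact/esym/comm_horner_mx.
have T4 : T *m T *m (T *m T) = M.
  have -> : T *m T *m (T *m T) = horner_mx M (q ^+ 4).
    by rewrite rmorphXn/= -/T !mulmxE -!expr2 -exprM.
  apply: (map_mx_inj (f := real_complex R)); rewrite map_horner_mx -/(cmx M).
  rewrite CME horner_mx_uconjC// horner_mx_diag; congr (_ *m diag_mx _ *m _).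
  apply/rowP => i; rewrite mxE DE rmorphXn/= horner_exp horner_map/=.
  by rewrite -rmorphXn/= qd.
exists (T *m T); split=> //; split; first by rewrite trmx_mul Tsym.
move=> x; rewrite mulmxA -[x^T *m T]trmxK -mulmxA trmx_mul trmxK Tsym mxE.
by apply: sumr_ge0 => i _; rewrite mxE -expr2 sqr_ge0.
Qed.

Lemma psd_sqrtmxP n (M : 'M[R]_n) :
  psd M -> psd (sqrtmx M) /\ sqrtmx M *m sqrtmx M = M.
Proof. by move=> /psd_sqrt_ex; exact: xgetPex. Qed.

(* [B, A B, ..., A^(n-1) B] has full row rank *)
Definition controllable n m (A : 'M[R]_n) (B : 'M[R]_(n, m)) : Prop :=
  \rank (\mxrow_(i < n) (A ^+ i *m B)) = n.

(* the stacked matrix [C; C A; ...; C A^(n-1)] has full column rank *)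
Definition observable n p (C : 'M[R]_(p, n)) (A : 'M[R]_n) : Prop :=
  \rank (\mxcol_(i < n) (C *m A ^+ i)) = n.

Definition stable n (A : 'M[R]_n) : Prop :=
  forall z : R[i], eigenvalue (cmx A) z -> complex.Re z < 0.

End LinearAlgebra.

Section TransferFunction.
Variable R : realType.

(* invmx returns its argument unchanged on singular matrices, so this is the
   transfer function only for s outside the spectrum of A. *)
Definition transfer n q r (A : 'M[R]_n) (B : 'M[R]_(n, q)) (C : 'M[R]_(r, n))
    (s : R[i]) : 'M[R[i]]_(r, q) :=
  cmx C *m invmx (s%:M - cmx A) *m cmx B.

(* Extended-real valued; the trace below is a nonnegative real number, so
   taking its real part loses nothing. *)
Definition H2norm q r (T : R[i] -> 'M[R[i]]_(r, q)) : \bar R :=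
  sqrte (((2 * pi)^-1)%:E *
    \int[lebesgue_measure]_(w in [set: R])
      (complex.Re (\tr ((T (0 +i* w)) ^t* *m T (0 +i* w))))%:E)%E.

End TransferFunction.

Section LQG.
Variable R : realType.
Variables n m p : nat.
Variables (A : 'M[R]_n) (B : 'M[R]_(n, m)) (C : 'M[R]_(p, n)).
Variables (Q W : 'M[R]_n) (Rw : 'M[R]_m) (V : 'M[R]_p).
Implicit Types K : 'M[R]_(m + n, p + n).

Definition CK K : 'M[R]_(m, n) := ursubmx K.
Definition BK K : 'M[R]_(n, p) := dlsubmx K.
Definition AK K : 'M[R]_n := drsubmx K.

Definition policies : set 'M[R]_(m + n, p + n) := [set K | ulsubmx K = 0].

Definition Acl K : 'M[R]_(n + n) := block_mx A (B *m CK K) (BK K *m C) (AK K).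

Definition Bcl K : 'M[R]_(n + n, n + p) :=
  block_mx (sqrtmx W) 0 0 (BK K *m sqrtmx V).

Definition Ccl K : 'M[R]_(n + m, n + n) :=
  block_mx (sqrtmx Q) 0 0 (sqrtmx Rw *m CK K).

Definition stabilizing : set 'M[R]_(m + n, p + n) :=
  [set K | policies K /\ stable (Acl K)].

(* Boundary relative to the subspace of policies, not to the ambient matrix
   space (in which the stabilizing set has empty interior). *)
Definition stabilizing_boundary : set 'M[R]_(m + n, p + n) :=
  policies `&` closure stabilizing `&` closure (policies `\` stabilizing).

Definition JLQG K : \bar R := H2norm (transfer (Acl K) (Bcl K) (Ccl K)).

End LQG.

(* Main.v *)
Require Import Defs.
From mathcomp Require Import all_boot all_order all_algebra.
From mathcomp Require Import all_fingroup.
From mathcomp Require Import ring lra.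
From mathcomp Require Import complex.
From mathcomp Require Import all_classical all_reals all_analysis.
Import Order.TTheory GRing.Theory Num.Theory.
Import numFieldNormedType.Exports.
Local Open Scope classical_set_scope.
Local Open Scope ring_scope.

(** The limit policy lies in the closure of the stabilizing policies and in the
    closure of the others, so its closed-loop matrix [a] has an eigenvalue
    [i w0] on the imaginary axis ([boundary_imaginary_eigenvalue]). Because
    plant and limit policy are minimal, this mode can be both excited by the
    closed-loop input and seen in the closed-loop output
    ([closed_loop_controllable], [closed_loop_observable]), so the transfer
    function of the limit has a genuine pole at [i w0].

    This pole is felt uniformly by all nearby closed loops. Controllability and
    observability of the mode give identities [P (lam - a) + L c = 1] and
    [(lam - a) P' + b L' = 1] with [lam = i w0]. They survive small
    perturbations up to a small error, and then bound the resolvent by an affine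
    function of the transfer function. On the other hand, if [a1] is within [e]
    of [a] and [s] within [e] of [lam], then [s - a1] nearly annihilates an
    eigenvector of [a], so its inverse has norm of order at least [1 / e].
    Hence the gain at [s] is at least [g / e] for some constant [g > 0]
    ([near_singular_gain], [transfer_near_imaginary_pole]).

    Once the closed loop of [K t] is within [e] of its limit, this holds for all
    frequencies in [[w0, w0 + e]], and the squared H2 norm is at least a
    constant times [(g / e) ^ 2 * e = g ^ 2 / e] ([H2norm_ge]), which is
    arbitrarily large. *)

Set Implicit Arguments.
Unset Strict Implicit.
Unset Printing Implicit Defensive.

(** * The entrywise 1-norm of complex matrices *)

Section EntrywiseNorm.
Context {R : realType}.
Notation C := R[i].
Notation normc := (@Normc.normc R).

Lemma normc_ge0 (x : C) : 0 <= normc x.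
Proof. by case: x => a b; exact: sqrtr_ge0. Qed.

Lemma normcD (x y : C) : normc (x + y) <= normc x + normc y.
Proof. exact: le_normcD. Qed.

Lemma normcN (x : C) : normc (- x) = normc x.
Proof. exact: complex.normcN. Qed.

Lemma normc_sum I (r : seq I) (P : pred I) (F : I -> C) :
  normc (\sum_(i <- r | P i) F i) <= \sum_(i <- r | P i) normc (F i).
Proof.
elim/big_rec2: _ => [|i a b _ IH]; first by rewrite Normc.normc0.
by rewrite (le_trans (normcD _ _))// lerD2l.
Qed.

Lemma normc_prod I (r : seq I) (P : pred I) (F : I -> C) :
  normc (\prod_(i <- r | P i) F i) = \prod_(i <- r | P i) normc (F i).
Proof. exact: (big_morph _ (@Normc.normcM R) (Normc.normc1 R)). Qed.

Lemma normc_sign (b : nat) : normc ((-1) ^+ b) = 1.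
Proof.
elim: b => [|b IH]; first exact: Normc.normc1.
by rewrite exprS Normc.normcM normcN Normc.normc1 IH mulr1.
Qed.

Lemma Re_le_normc (x : C) : complex.Re x <= normc x.
Proof.
case: x => a b /=; rewrite (le_trans (ler_norm a))// -sqrtr_sqr ler_sqrt//.
  by rewrite lerDl sqr_ge0.
by rewrite addr_ge0 ?sqr_ge0.
Qed.

(** Real-valued, submultiplicative, and defined for all dimensions, including
    those that are not syntactically successors. *)
Definition mxnrm m n (M : 'M[C]_(m, n)) : R := \sum_i \sum_j normc (M i j).

Lemma mxnrm_ge0 m n (M : 'M[C]_(m, n)) : 0 <= mxnrm M.
Proof. by do 2!apply: sumr_ge0 => ? _; exact: normc_ge0. Qed.

Lemma mxnrmD m n (M N : 'M[C]_(m, n)) : mxnrm (M + N) <= mxnrm M + mxnrm N.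
Proof.
rewrite /mxnrm -big_split; apply: ler_sum => i _.
by rewrite -big_split; apply: ler_sum => j _; rewrite mxE normcD.
Qed.

Lemma mxnrmN m n (M : 'M[C]_(m, n)) : mxnrm (- M) = mxnrm M.
Proof. by do 2!apply: eq_bigr => ? _; rewrite mxE normcN. Qed.

Lemma mxnrmB m n (M N : 'M[C]_(m, n)) : mxnrm (M - N) = mxnrm (N - M).
Proof. by rewrite -mxnrmN opprB. Qed.

Lemma mxnrmM m n q (M : 'M[C]_(m, n)) (N : 'M[C]_(n, q)) :
  mxnrm (M *m N) <= mxnrm M * mxnrm N.
Proof.
have row_le k : 0 <= \sum_j normc (N k j).
  by apply: sumr_ge0 => j _; exact: normc_ge0.
rewrite /mxnrm mulr_suml; apply: ler_sum => i _.
apply: (@le_trans _ _ (\sum_k normc (M i k) * \sum_j normc (N k j))).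
  under [leRHS]eq_bigr do rewrite mulr_sumr.
  rewrite exchange_big; apply: ler_sum => j _; rewrite mxE.
  rewrite (le_trans (normc_sum _ _ _))//; apply: ler_sum => k _.
  by rewrite Normc.normcM.
rewrite mulr_suml; apply: ler_sum => k _.
rewrite ler_wpM2l ?normc_ge0// (bigD1 k)//= lerDl.
by apply: sumr_ge0 => l _.
Qed.

Lemma mxnrmM_le m n q (M : 'M[C]_(m, n)) (N : 'M[C]_(n, q)) u v :
  mxnrm M <= u -> mxnrm N <= v -> mxnrm (M *m N) <= u * v.
Proof.
by move=> Mu Nv; rewrite (le_trans (mxnrmM _ _))// ler_pM ?mxnrm_ge0.
Qed.

Lemma mxnrmZ m n a (M : 'M[C]_(m, n)) : mxnrm (a *: M) = normc a * mxnrm M.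
Proof.
rewrite /mxnrm mulr_sumr; apply: eq_bigr => i _.
by rewrite mulr_sumr; apply: eq_bigr => j _; rewrite mxE Normc.normcM.
Qed.

Lemma mxnrm_entry m n (M : 'M[C]_(m, n)) i j : normc (M i j) <= mxnrm M.
Proof.
rewrite /mxnrm (bigD1 i)//= (bigD1 j)//= -addrA lerDl.
by rewrite addr_ge0 ?sumr_ge0// => *; rewrite ?sumr_ge0// => *;
  exact: normc_ge0.
Qed.

Lemma mxnrm_le m n (M : 'M[C]_(m, n)) b :
  (forall i j, normc (M i j) <= b) -> mxnrm M <= (m * n)%:R * b.
Proof.
move=> Mb; apply: (@le_trans _ _ (\sum_(i < m) \sum_(j < n) b)).
  by do 2!apply: ler_sum => ? _.
by rewrite !sumr_const !card_ord -mulrnA mulr_natl mulnC.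
Qed.

Lemma mxnrm_gt0 m n (M : 'M[C]_(m, n)) : M != 0 -> 0 < mxnrm M.
Proof.
move=> M0; rewrite lt_neqAle mxnrm_ge0 andbT; apply: contra_neq M0 => M0.
apply/matrixP => i j; rewrite mxE; apply: Normc.eq0_normc.
by apply/eqP; rewrite eq_le normc_ge0 andbT M0 mxnrm_entry.
Qed.

Lemma mxnrm_scalar n a : mxnrm (a%:M : 'M[C]_n) = n%:R * normc a.
Proof.
rewrite /mxnrm (eq_bigr (fun=> normc a)).
  by rewrite sumr_const card_ord mulr_natl.
move=> i _.
rewrite (bigD1 i)//= mxE eqxx mulr1n big1 ?addr0// => j /negPf ji.
by rewrite mxE eq_sym ji mulr0n Normc.normc0.
Qed.

Lemma mxnrm_block m1 m2 n1 n2 (a : 'M[C]_(m1, n1)) (b : 'M[C]_(m1, n2))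
    (c : 'M[C]_(m2, n1)) (d : 'M[C]_(m2, n2)) :
  mxnrm (block_mx a b c d) = mxnrm a + mxnrm b + mxnrm c + mxnrm d.
Proof.
rewrite /mxnrm big_split_ord/= -addrA -!big_split/=.
by congr (_ + _); apply: eq_bigr => i _; rewrite big_split_ord/=;
  congr (_ + _); apply: eq_bigr => j _;
  rewrite ?block_mxEul ?block_mxEur ?block_mxEdl ?block_mxEdr.
Qed.

End EntrywiseNorm.

(** * Perturbation of the spectrum *)

Section Spectrum.
Context {R : realType}.
Notation C := R[i].
Notation normc := (@Normc.normc R).

Lemma normc_det_le n (X : 'M[C]_n) b :
  (forall i j, normc (X i j) <= b) -> normc (\det X) <= n`!%:R * b ^+ n.
Proof.
move=> Xb; rewrite /determinant; apply: le_trans (normc_sum _ _ _) _.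
apply: (@le_trans _ _ (\sum_(s : 'S_n) b ^+ n)).
  apply: ler_sum => s _; rewrite Normc.normcM normc_sign mul1r normc_prod.
  rewrite -[X in b ^+ X](card_ord n) -prodr_const; apply: ler_prod => i _.
  by rewrite normc_ge0 Xb.
by rewrite sumr_const mulr_natl (_ : #|_| = n`!)%N//; exact: card_Sn.
Qed.

Lemma mxnrm_adj_le n (X : 'M[C]_n) b : (forall i j, normc (X i j) <= b) ->
  mxnrm (\adj X) <= (n * n)%:R * (n.-1`!%:R * b ^+ n.-1).
Proof.
move=> Xb; apply: mxnrm_le => i j; rewrite mxE /cofactor.
rewrite Normc.normcM normc_sign mul1r; apply: normc_det_le => k l.
by rewrite !mxE.
Qed.

(** An eigenvector [x] of [X] for [lam] satisfies
    [x (lam - Y) = x (X - Y)]; multiplying by the adjugate of [lam - Y]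
    turns this into [det (lam - Y) x = x (X - Y) adj (lam - Y)]. *)
Lemma det_perturbed_eigenvalue_le n (X Y : 'M[C]_n) lam :
  eigenvalue X lam ->
  normc (\det (lam%:M - Y)) <= mxnrm (X - Y) *
    ((n * n)%:R * (n.-1`!%:R * (mxnrm X + mxnrm Y) ^+ n.-1)).
Proof.
move=> /eigenvalueP[x xX x0]; have nx := mxnrm_gt0 x0.
have lamX : normc lam <= mxnrm X.
  by rewrite -(ler_pM2r nx) -mxnrmZ -xX mulrC mxnrmM.
have entryY i j : normc ((lam%:M - Y) i j) <= mxnrm X + mxnrm Y.
  rewrite !mxE (le_trans (normcD _ _))// lerD//; last first.
    by rewrite normcN mxnrm_entry.
  by case: (i == j); rewrite ?mulr1n// mulr0n Normc.normc0 mxnrm_ge0.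
rewrite -(ler_pM2r nx) -mxnrmZ.
have -> : \det (lam%:M - Y) *: x = x *m (X - Y) *m \adj (lam%:M - Y).
  by rewrite mulmxBr xX -!mul_mx_scalar -mulmxBr -mulmxA mul_mx_adj.
rewrite (le_trans (mxnrmM _ _))//.
apply: (@le_trans _ _ (mxnrm x * mxnrm (X - Y) * mxnrm (\adj (lam%:M - Y)))).
  by rewrite ler_wpM2r ?mxnrm_ge0 ?mxnrmM.
rewrite -mulrA [leLHS]mulrC ler_pM2r// ler_wpM2l ?mxnrm_ge0//.
exact: mxnrm_adj_le.
Qed.

Lemma horner_char_poly n (Y : 'M[C]_n) lam :
  (char_poly Y).[lam] = \det (lam%:M - Y).
Proof.
rewrite /char_poly -[LHS]/(horner_eval lam _) -det_map_mx; congr (\det _).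
apply/matrixP => i j; rewrite !mxE/= /horner_eval hornerD hornerN hornerC.
by rewrite hornerMn hornerX.
Qed.

Lemma det_resolvent_prod n (Y : 'M[C]_n) :
  exists2 zs : seq C, size zs = n /\ all (eigenvalue Y) zs &
    forall lam, \det (lam%:M - Y) = \prod_(z <- zs) (lam - z).
Proof.
have [zs Ezs] := closed_field_poly_normal (char_poly Y).
rewrite (monicP (char_poly_monic Y)) scale1r in Ezs.
exists zs.
  split; first by have := size_char_poly Y; rewrite Ezs size_prod_XsubC => -[].
  apply/allP => z zzs; rewrite eigenvalue_root_char Ezs.
  by rewrite root_prod_XsubC.
move=> lam; rewrite -horner_char_poly Ezs horner_prod.
by apply: eq_bigr => z _; rewrite hornerXsubC.
Qed.

(** The determinant is the product of the [lam - z] over the eigenvalues [z];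
    as [Re z < 0 <= Re lam], each factor is at least [- Re z] and at least
    [Re lam]. The first bound is uniform in [lam], the second one in [Y]: they
    control unstable matrices near a stable one and stable matrices near an
    unstable one, respectively. *)
Lemma stable_det_ge n (Y : 'M[R]_n) : stable Y ->
  exists2 c : R, 0 < c & forall lam, 0 <= complex.Re lam ->
    c <= normc (\det (lam%:M - cmx Y)) /\
    complex.Re lam ^+ n <= normc (\det (lam%:M - cmx Y)).
Proof.
move=> Yst; have [zs [szs /allP zsY] detE] := det_resolvent_prod (cmx Y).
exists (\prod_(z <- zs) (- complex.Re z)).
  rewrite big_seq; apply: prodr_gt0 => z zzs; rewrite oppr_gt0.
  exact/Yst/zsY.
move=> lam lam0; rewrite detE normc_prod.
have dist z : z \in zs ->
    - complex.Re z <= normc (lam - z) /\ complex.Re lam <= normc (lam - z).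
  move=> zzs; have := Yst _ (zsY _ zzs); have := Re_le_normc (lam - z).
  have -> : complex.Re (lam - z) = complex.Re lam - complex.Re z.
    by case: (lam) (z) => [? ?] [].
  by split; lra.
split; last rewrite -szs -count_predT -iter_mulr_1 -big_const_seq.
  rewrite big_seq [leRHS]big_seq; apply: ler_prod => z zzs.
  rewrite (dist _ zzs).1 andbT oppr_ge0 ltW//; exact/Yst/zsY.
rewrite big_seq [leRHS]big_seq; apply: ler_prod => z zzs.
by rewrite (dist _ zzs).2 lam0.
Qed.

End Spectrum.

Section BoundarySpectrum.
Context {R : realType}.

Lemma pos_not_le_small (c k : R) : 0 < c -> 0 <= k ->
  ~ (forall e, 0 < e -> e <= 1 -> c <= e * k).
Proof.
move=> c0 k0 /(_ (c / (c + k + 1))).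
have d0 : 0 < c + k + 1 by rewrite addr_gt0// ltr_wpDr.
rewrite divr_gt0// ler_pdivrMr// mul1r => /(_ isT).
have -> : c <= c + k + 1 by lra.
rewrite mulrAC ler_pdivlMr// ler_pM2l// => /(_ isT); lra.
Qed.

(** If all eigenvalues of [Y] were stable, [det (lam - Y)] would be bounded away
    from [0] on the closed right half-plane, but it is small at the unstable
    eigenvalues of matrices near [Y]. If [Y] had an eigenvalue [lam] with
    [Re lam > 0], then [det (lam - X)] would be small for [X] near [Y], but it
    is at least [Re lam ^ n] for stable [X]. *)
Lemma imaginary_eigenvalue n (Y : 'M[R]_n) :
  (forall e, 0 < e -> exists2 X, stable X & mxnrm (cmx X - cmx Y) < e) ->
  (forall e, 0 < e -> exists2 X, ~ stable X & mxnrm (cmx X - cmx Y) < e) ->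
  exists w, eigenvalue (cmx Y) (0 +i* w)%C.
Proof.
move=> st unst.
pose k := (n * n)%:R * (n.-1`!%:R * (mxnrm (cmx Y) *+ 2 + 1) ^+ n.-1).
have y0 := mxnrm_ge0 (cmx Y).
have k0 : 0 <= k by rewrite !mulr_ge0// exprn_ge0// addr_ge0// mulrn_wge0.
have near (X1 X2 : 'M[R]_n) e lam : e <= 1 ->
    mxnrm (cmx X1 - cmx X2) < e ->
    mxnrm (cmx X1) + mxnrm (cmx X2) <= mxnrm (cmx Y) *+ 2 + 1 ->
    eigenvalue (cmx X1) lam ->
    Normc.normc (\det (lam%:M - cmx X2)) <= e * k.
  move=> e1 X12 X12Y eig; apply: le_trans (det_perturbed_eigenvalue_le _ eig) _.
  apply: ler_pM; rewrite ?mxnrm_ge0 ?(ltW X12)//.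
    by rewrite !mulr_ge0// exprn_ge0// addr_ge0 ?mxnrm_ge0.
  do 2!(rewrite ler_wpM2l//).
  by rewrite lerXn2r// nnegrE addr_ge0 ?mxnrm_ge0 ?mulrn_wge0.
have ball_nrm X e : e <= 1 -> mxnrm (cmx X - cmx Y) < e ->
    mxnrm (cmx X) <= mxnrm (cmx Y) + 1.
  move=> e1 XY; rewrite -[cmx X](subrK (cmx Y)) addrC.
  by rewrite (le_trans (mxnrmD _ _))// lerD2l; lra.
have [[lam Ylam lam0]|noeig] := pselect (exists2 lam,
    eigenvalue (cmx Y) lam & 0 <= complex.Re lam).
  have [lamgt0|lam_le0] := ltP 0 (complex.Re lam).
    case: (pos_not_le_small (exprn_gt0 n lamgt0) k0) => e e0 e1.
    have [X Xst XY] := st _ e0.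
    have [c _ /(_ _ lam0)[_ detX]] := stable_det_ge Xst.
    apply: le_trans detX _; apply: near Ylam => //; first by rewrite mxnrmB.
    by have := ball_nrm _ _ e1 XY; rewrite mulr2n; lra.
  exists (complex.Im lam); have -> // : (0 +i* complex.Im lam)%C = lam.
  by case: (lam) lam0 lam_le0 => a b /= a0 b0; congr (_ +i* _)%C; lra.
have Yst : stable Y.
  by move=> z Yz; rewrite ltNge; apply/negP => z0; apply: noeig; exists z.
have [c c0 Yc] := stable_det_ge Yst.
case: (pos_not_le_small c0 k0) => e e0 e1.
have [X /existsNP[z /not_implyP[Xz /negP z0]] XY] := unst _ e0.
rewrite -leNgt in z0; have [cz _] := Yc _ z0.
apply: le_trans cz _; apply: near Xz => //.
by have := ball_nrm _ _ e1 XY; rewrite mulr2n; lra.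
Qed.

End BoundarySpectrum.

(** * The Hautus test and coprime factor identities *)

Section Hautus.
Context {R : realType}.
Notation C := R[i].

Lemma controllable_Hautus n m (A : 'M[R]_n) (B : 'M[R]_(n, m)) lam
    (x : 'rV[C]_n) :
  controllable A B -> x *m cmx A = lam *: x -> x *m cmx B = 0 -> x = 0.
Proof.
move=> ctrl xA xB; set M := \mxrow_(i < n) (A ^+ i *m B) in ctrl *.
have : row_free (cmx M) by rewrite row_free_map /row_free ctrl.
move=> /mulmx_free_eq0 free; apply/eqP; rewrite -free; apply/eqP.
have xAk k : x *m cmx (A ^+ k) = lam ^+ k *: x.
  elim: k => [|k IH]; first by rewrite !expr0 scale1r /cmx map_mx1 mulmx1.
  by rewrite exprS /cmx map_mxM mulmxA xA -scalemxAl IH scalerA exprS.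
have -> : cmx M = \mxrow_(i < n) (cmx (A ^+ i *m B)).
  by apply/matrixP => i j; rewrite !mxE.
have xAB k : x *m cmx (A ^+ k *m B) = 0.
  by rewrite /cmx map_mxM mulmxA xAk -scalemxAl xB scaler0.
by rewrite mul_mxrow; apply/matrixP => i j; rewrite mxE xAB !mxE.
Qed.

Lemma observable_tr n p (C : 'M[R]_(p, n)) (A : 'M[R]_n) :
  observable C A -> controllable A^T C^T.
Proof.
rewrite /observable /controllable -mxrank_tr tr_mxcol => obs.
rewrite -[RHS]obs; congr (\rank _); apply: eq_mxrow => i.
rewrite trmx_mul; congr (_ *m _).
elim: (val i) => [|k IH]; first by rewrite !expr0 trmx1.
by rewrite exprS exprSr trmx_mul IH.
Qed.

Lemma observable_Hautus n p (Co : 'M[R]_(p, n)) (A : 'M[R]_n) lam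
    (x : 'cV[C]_n) :
  observable Co A -> cmx A *m x = lam *: x -> cmx Co *m x = 0 -> x = 0.
Proof.
move=> /observable_tr ctrl Ax Cx; apply: trmx_inj; rewrite trmx0.
apply: (controllable_Hautus (lam := lam) ctrl);
  rewrite /cmx -map_trmx -trmx_mul.
  by rewrite Ax linearZ.
by rewrite Cx trmx0.
Qed.

(** The Hautus test at one point of the spectrum, with [D = lam - A], amounts to
    one-sided invertibility of the block matrix [[D b]]. *)
Lemma right_coprime_inverse n q (D : 'M[C]_n) (b : 'M[C]_(n, q)) :
  (forall x : 'rV_n, x *m D = 0 -> x *m b = 0 -> x = 0) ->
  exists P L, D *m P + b *m L = 1%:M.
Proof.
move=> Db; have /row_freeP[X DX] : row_free (row_mx D b).
  rewrite -kermx_eq0; apply/eqP/row_matrixP => i; rewrite row0.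
  have /sub_kermxP : (row i (kermx (row_mx D b)) <= kermx (row_mx D b))%MS.
    exact: row_sub.
  by rewrite mul_mx_row -row_mx0 => /eq_row_mx[]; exact: Db.
by exists (usubmx X), (dsubmx X); rewrite -mul_row_col vsubmxK.
Qed.

Lemma left_coprime_inverse n r (D : 'M[C]_n) (c : 'M[C]_(r, n)) :
  (forall x : 'cV_n, D *m x = 0 -> c *m x = 0 -> x = 0) ->
  exists P L, P *m D + L *m c = 1%:M.
Proof.
move=> Dc; have [|P [L PL]] := @right_coprime_inverse _ _ D^T c^T.
  move=> x xD xc; apply: trmx_inj; rewrite trmx0.
  by apply: Dc; apply: trmx_inj; rewrite trmx_mul trmxK trmx0.
exists P^T, L^T; apply: trmx_inj.
by rewrite linearD/= !trmx_mul !trmxK PL trmx1.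
Qed.

End Hautus.

(** * Gain near an imaginary pole *)

Section ResolventGain.
Context {R : realType}.
Notation C := R[i].

(** Write [Rs = D1^-1] and [X = Rs b1]. The two identities for [D], once rewritten
    for [D1] and multiplied by [X] on the right, respectively [Rs] on the left,
    express [X] through [G = c1 X] and then [Rs] through [X], with error terms
    of relative size [h k] which are absorbed on the left-hand side; so [Rs] is
    bounded by an affine function of [G]. Since [x D = 0], one has
    [x = x (D1 - D) Rs], which forces [1 <= h * mxnrm Rs]. *)
Lemma near_singular_gain N q r (D D1 : 'M[C]_N) (b b1 : 'M[C]_(N, q))
    (c c1 : 'M[C]_(r, N)) P L P' L' (x : 'rV[C]_N) k h :
  P *m D + L *m c = 1%:M -> D *m P' + b *m L' = 1%:M ->
  x != 0 -> x *m D = 0 -> D1 \in unitmx ->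
  mxnrm P <= k -> mxnrm L <= k -> mxnrm P' <= k -> mxnrm L' <= k ->
  mxnrm b1 <= k -> mxnrm (D1 - D) <= h -> mxnrm (b1 - b) <= h ->
  mxnrm (c1 - c) <= h -> h * (4 * k + 8 * k ^+ 3) <= 1 ->
  1 <= h * (8 * k ^+ 2) * mxnrm (c1 *m invmx D1 *m b1).
Proof.
move=> PL PL' x0 xD D1u Pk Lk Pk' Lk' b1k Dh bh ch hsmall.
set Rs := invmx D1; set G := c1 *m Rs *m b1; pose X := Rs *m b1.
have k0 : 0 <= k := le_trans (mxnrm_ge0 _) Pk.
have h0 : 0 <= h := le_trans (mxnrm_ge0 _) Dh.
have hk : 4 * (h * k) <= 1.
  apply: le_trans hsmall; rewrite mulrCA ler_wpM2l// lerDl.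
  by rewrite mulr_ge0// exprn_ge0.
(* Absorption: the error term is at most [t / 2]. *)
have half (t u : R) : 0 <= t -> t <= u + h * k *+ 2 * t -> t <= 2 * u.
  by move=> t0 tu; rewrite mulr2n in tu; nra.
have X_le : mxnrm X <= 2 * (k * k + k * mxnrm G).
  apply: half; first exact: mxnrm_ge0.
  have {1}-> : X = P *m b1 + L *m G - (P *m (D1 - D) + L *m (c1 - c)) *m X.
    have -> : P *m (D1 - D) + L *m (c1 - c) = P *m D1 + L *m c1 - 1%:M.
      by rewrite -PL !mulmxBr opprD addrACA.
    rewrite mulmxBl mul1mx mulmxDl -!mulmxA -/X.
    rewrite [D1 *m X]mulmxA mulmxV// mul1mx /G -mulmxA -/X.
    by rewrite opprB addrCA subrr addr0.
  rewrite (le_trans (mxnrmD _ _))// mxnrmN lerD//.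
    by rewrite (le_trans (mxnrmD _ _))// lerD// mxnrmM_le.
  apply: mxnrmM_le => //; rewrite (le_trans (mxnrmD _ _))// [h * k]mulrC mulr2n.
  by apply: lerD; apply: mxnrmM_le.
have R_le : mxnrm Rs <= 2 * (k + mxnrm X * k).
  apply: half; first exact: mxnrm_ge0.
  have {1}-> : Rs = P' + X *m L' - Rs *m ((D1 - D) *m P' + (b1 - b) *m L').
    have -> : (D1 - D) *m P' + (b1 - b) *m L' = D1 *m P' + b1 *m L' - 1%:M.
      by rewrite -PL' !mulmxBl opprD addrACA.
    rewrite mulmxBr mulmx1 mulmxDr !mulmxA -/X.
    by rewrite mulVmx// mul1mx opprB addrCA subrr addr0.
  rewrite (le_trans (mxnrmD _ _))// mxnrmN lerD//.
    by rewrite (le_trans (mxnrmD _ _))// lerD// mxnrmM_le.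
  rewrite [leRHS]mulrC; apply: mxnrmM_le => //.
  by rewrite (le_trans (mxnrmD _ _))// mulr2n; apply: lerD; apply: mxnrmM_le.
have hR : 1 <= h * mxnrm Rs.
  rewrite -(ler_pM2l (mxnrm_gt0 x0)) mulr1.
  have {1}-> : x = x *m ((D1 - D) *m Rs).
    by rewrite mulmxA mulmxBr xD subr0 -mulmxA mulmxV// mulmx1.
  by do 2!apply: mxnrmM_le => //.
have g0 := mxnrm_ge0 G.
have : mxnrm X * k <= 2 * (k * k + k * mxnrm G) * k by rewrite ler_wpM2r.
move=> Xk; have : h * mxnrm Rs <=
    h * (2 * (k + 2 * (k * k + k * mxnrm G) * k)).
  by rewrite ler_wpM2l// (le_trans R_le)// ler_wpM2l// lerD2l.
move=> hR2; move: hsmall; rewrite !exprS expr0; lra.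
Qed.

End ResolventGain.

Section TransferGain.
Context {R : realType}.
Notation C := R[i].

Lemma stable_resolvent_unit n (a : 'M[R]_n) (s : C) :
  stable a -> 0 <= complex.Re s -> s%:M - cmx a \in unitmx.
Proof.
move=> /stable_det_ge[c c0 detc] /detc[+ _]; rewrite unitmxE unitfE => cdet.
by apply: contraTneq cdet => ->; rewrite Normc.normc0 -ltNge.
Qed.

(** Instance of [near_singular_gain] with [D = lam - a] and [D1 = i w - a1], which
    differ by at most [(N + 1) e]: the identity matrix has norm [N]. *)
Lemma transfer_near_imaginary_pole N q r (a : 'M[R]_N) (b : 'M[R]_(N, q))
    (c : 'M[R]_(r, N)) w0 (lam := (0 +i* w0)%C) :
  eigenvalue (cmx a) lam ->
  (forall x : 'rV_N, x *m cmx a = lam *: x -> x *m cmx b = 0 -> x = 0) ->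
  (forall x : 'cV_N, cmx a *m x = lam *: x -> cmx c *m x = 0 -> x = 0) ->
  exists2 g : R, 0 < g & exists2 d : R, 0 < d &
    forall e a1 b1 c1 w, 0 < e -> e <= d -> stable a1 ->
      mxnrm (cmx a1 - cmx a) <= e -> mxnrm (cmx b1 - cmx b) <= e ->
      mxnrm (cmx c1 - cmx c) <= e -> w0 <= w -> w <= w0 + e ->
      g <= e * mxnrm (transfer a1 b1 c1 (0 +i* w)%C).
Proof.
move=> /eigenvalueP[x xa x0] ctrl obs.
pose D := lam%:M - cmx a.
have [y yD yb|P' [L' PL']] := @right_coprime_inverse _ _ _ D (cmx b).
  apply: ctrl => //; apply/esym/eqP.
  by rewrite -mul_mx_scalar -subr_eq0 -mulmxBr yD.
have [y yD yc|P [L PL]] := @left_coprime_inverse _ _ _ D (cmx c).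
  apply: obs => //; apply/esym/eqP.
  by rewrite -mul_scalar_mx -subr_eq0 -mulmxBl yD.
(* The summand [1] leaves room for [b1], at distance at most [1] from [b], and
   makes the admissible [e] at most [1]. *)
pose k := 1 + mxnrm P + mxnrm L + mxnrm P' + mxnrm L' + mxnrm (cmx b).
have := mxnrm_ge0 P; have := mxnrm_ge0 L; have := mxnrm_ge0 P'.
have := mxnrm_ge0 L'; have := mxnrm_ge0 (cmx b).
move=> b0 L'0 P'0 L0 P0; have k1 : 1 <= k by rewrite /k; lra.
have k0 : 0 < k by lra.
have N0 : 0 < N.+1%:R :> R by rewrite ltr0n.
have N1 : 1 <= N.+1%:R :> R by rewrite ler1n.
have kk0 : 0 < 4 * k + 8 * k ^+ 3 by rewrite addr_gt0 ?mulr_gt0 ?exprn_gt0.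
have kk1 : 1 <= 4 * k + 8 * k ^+ 3.
  by rewrite ler_wpDr ?mulr_ge0 ?exprn_ge0 ?(ltW k0)//; lra.
exists (N.+1%:R * (8 * k ^+ 2))^-1.
  by rewrite invr_gt0 !mulr_gt0// exprn_gt0.
exists (N.+1%:R * (4 * k + 8 * k ^+ 3))^-1; first by rewrite invr_gt0 mulr_gt0.
move=> e a1 b1 c1 w e0 ed a1st aa1 bb1 cc1 w0w we.
have e1 : e <= 1.
  by rewrite (le_trans ed)// invf_le1 ?mulr_gt0//; apply: mulr_ege1.
rewrite /transfer; set s := (0 +i* w)%C.
have eN : e <= N.+1%:R * e by rewrite ler_peMl// ltW.
have xD : x *m D = 0 by rewrite mulmxBr xa mul_mx_scalar subrr.
have gain : 1 <= N.+1%:R * e * (8 * k ^+ 2) *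
    mxnrm (cmx c1 *m invmx (s%:M - cmx a1) *m cmx b1).
  apply: (near_singular_gain PL PL' x0 xD).
  - exact: stable_resolvent_unit.
  - by rewrite /k; lra.
  - by rewrite /k; lra.
  - by rewrite /k; lra.
  - by rewrite /k; lra.
  - rewrite -[cmx b1](subrK (cmx b)) (le_trans (mxnrmD _ _))// /k; lra.
  - have -> : s%:M - cmx a1 - D = (s - lam)%:M - (cmx a1 - cmx a).
      rewrite /D !opprB raddfB/= [cmx a - lam%:M]addrC addrACA.
      by rewrite [- _ + cmx a]addrC.
    rewrite (le_trans (mxnrmD _ _))// mxnrmN mxnrm_scalar -[N.+1]addn1 natrD.
    rewrite mulrDl mul1r lerD// ler_wpM2l//.
    have -> : s - lam = (0 +i* (w - w0))%C.
      by rewrite /s /lam; apply/eqP; rewrite eq_complex/= subr0 !eqxx.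
    by rewrite /= expr0n add0r sqrtr_sqr ger0_norm; lra.
  - exact: le_trans eN.
  - exact: le_trans eN.
  - rewrite mulrAC mulrC -ler_pdivlMr ?mulr_gt0// div1r//.
rewrite -[leLHS]mulr1 -ler_pdivlMl ?invr_gt0 ?mulr_gt0 ?exprn_gt0// invrK.
by apply: le_trans gain _; rewrite le_eqVlt; apply/orP; left; apply/eqP; ring.
Qed.

Lemma Re_trace_gram q r (T : 'M[C]_(r, q)) :
  complex.Re (\tr (T ^t* *m T)%sesqui) = \sum_i \sum_j Normc.normc (T j i) ^+ 2.
Proof.
suff -> : \tr (T ^t* *m T)%sesqui =
    (\sum_i \sum_j Normc.normc (T j i) ^+ 2)%:C%C by [].
rewrite rmorph_sum; apply: eq_bigr => i _; rewrite mxE rmorph_sum.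
by apply: eq_bigr => j _; rewrite !mxE -normCKC rmorphXn.
Qed.

(** The trace is the squared Frobenius norm of [T], which bounds each of the
    [r * q] entries. *)
Lemma mxnrm_sq_le q r (T : 'M[C]_(r, q)) :
  mxnrm T ^+ 2 <= (r * q)%:R ^+ 2 * complex.Re (\tr (T ^t* *m T)%sesqui).
Proof.
set S := complex.Re _.
have S0 : 0 <= S.
  by rewrite /S Re_trace_gram; do 2!apply: sumr_ge0 => ? _; exact: sqr_ge0.
have TS i j : Normc.normc (T i j) <= Num.sqrt S.
  rewrite -(ger0_norm (normc_ge0 _)) -sqrtr_sqr ler_sqrt// /S Re_trace_gram.
  rewrite (bigD1 j)//= (bigD1 i)//= -addrA lerDl addr_ge0// sumr_ge0// => *.
    exact: sqr_ge0.
  by apply: sumr_ge0 => *; exact: sqr_ge0.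
rewrite -[in leRHS](sqr_sqrtr S0) -exprMn.
rewrite lerXn2r ?nnegrE ?mxnrm_ge0 ?mulr_ge0 ?sqrtr_ge0//.
exact: mxnrm_le.
Qed.

Import HBNNSimple.

(** The integral of a nonnegative function is the supremum of the integrals of
    the simple functions below it, and a multiple of the indicator of the
    interval is one of these. *)
Lemma integral_ge_on_interval (f : R -> R) (u x e : R) :
  (forall w, 0 <= f w) -> 0 <= u -> 0 <= e ->
  (forall w, x <= w -> w <= x + e -> u <= f w) ->
  ((u * e)%:E <= \int[lebesgue_measure]_(w in [set: R]) (f w)%:E)%E.
Proof.
move=> f0 u0 e0 uf; pose I : set (measurableTypeR R) := `[x, x + e]%classic.
have mI : measurable I by exact: measurable_itv.
have mI_e : lebesgue_measure I = e%:E.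
  rewrite /I lebesgue_measure_itv/= lte_fin.
  case: ltP => xe; first by rewrite -EFinB addrAC subrr add0r.
  by congr EFin; lra.
have -> : (u * e)%:E =
    sintegral lebesgue_measure (scale_nnsfun (indic_nnsfun R mI) u0).
  rewrite [RHS](sintegralrM lebesgue_measure u (indic_nnsfun R mI)).
  rewrite EFinM; congr (_ * _)%E; symmetry.
  by rewrite -[RHS]mI_e -[RHS]sintegral_indic.
rewrite ge0_integralTE => [|w]; last by rewrite lee_fin.
apply: ereal_sup_ubound => /=.
exists (scale_nnsfun (indic_nnsfun R mI) u0) => // w.
rewrite lee_fin -[leLHS]/(u * \1_I w) indicE.
have [|] := boolP (w \in I); last by rewrite mulr0.
by rewrite inE /I/= in_itv/= mulr1 => /andP[]; exact: uf.
Qed.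



(** The square of the gain is at least [(g / e) ^ 2] on an interval of length
    [e]. The summand [1] only serves to keep the constant invertible when
    [r * q = 0]. *)
Lemma H2norm_ge q r (T : C -> 'M[C]_(r, q)) (x e g : R) :
  0 < e -> 0 <= g ->
  (forall w, x <= w -> w <= x + e -> g <= e * mxnrm (T (0 +i* w)%C)) ->
  (sqrte ((2 * pi * ((r * q)%:R ^+ 2 + 1))^-1 * g ^+ 2 / e)%:E <= H2norm T)%E.
Proof.
move=> e0 g0 Tg; set d := (r * q)%:R ^+ 2 + 1.
have d0 : 0 < d by rewrite ltr_wpDl ?sqr_ge0.
have p0 : 0 < 2 * pi :> R by rewrite mulr_gt0 ?pi_gt0.
have tr_ge0 w :
    0 <= complex.Re (\tr (T (0 +i* w)%C ^t* *m T (0 +i* w)%C)%sesqui).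
  by rewrite Re_trace_gram; do 2!apply: sumr_ge0 => ? _; exact: sqr_ge0.
rewrite /H2norm; move: (2 * pi) p0 => P p0; rewrite lee_sqrt; last first.
  apply: mule_ge0; first by rewrite lee_fin invr_ge0 ltW.
  by apply: integral_ge0 => w _; rewrite lee_fin.
have -> : (P * d)^-1 * g ^+ 2 / e =
    P^-1 * (d^-1 * (g / e) ^+ 2 * e).
  by field; rewrite !gt_eqF.
rewrite EFinM lee_wpmul2l ?lee_fin ?invr_ge0 ?(ltW p0)//.
apply: (@integral_ge_on_interval _ _ x) => [//|||w xw we].
- by rewrite mulr_ge0 ?sqr_ge0 ?invr_ge0 ?ltW.
- exact: ltW.
rewrite mulrC ler_pdivrMr//.
have ge : g / e <= mxnrm (T (0 +i* w)%C) by rewrite ler_pdivrMr// mulrC Tg.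
apply: (@le_trans _ _ (mxnrm (T (0 +i* w)%C) ^+ 2)).
  by apply: lerXn2r => //; rewrite nnegrE ?mxnrm_ge0// divr_ge0// ltW.
apply: le_trans (mxnrm_sq_le _) _; rewrite mulrC ler_wpM2l//.
by rewrite lerDl.
Qed.

End TransferGain.

(** * The closed loop *)

Section ClosedLoop.
Context {R : realType}.
Notation C := R[i].

Lemma pd_unitmx n (M : 'M[R]_n) : pd M -> M \in unitmx.
Proof.
move=> [_ Mpos]; rewrite -row_free_unit -kermx_eq0; apply/eqP/row_matrixP => i.
rewrite row0; apply/eqP; apply: contraT => x0.
have := Mpos (row i (kermx M))^T; rewrite trmx_eq0 x0 trmxK => /(_ isT).
by rewrite -row_mul mulmx_ker row0 mul0mx mxE ltxx.
Qed.

Lemma pd_psd n (M : 'M[R]_n) : pd M -> psd M.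
Proof.
move=> [sM Mpos]; split=> // x; have [->|/Mpos/ltW//] := eqVneq x 0.
by rewrite mulmx0 mxE.
Qed.

Lemma pd_sqrtmx_unit n (M : 'M[R]_n) : pd M -> cmx (sqrtmx M) \in unitmx.
Proof.
move=> Mpd; have [_ SM] := psd_sqrtmxP (pd_psd Mpd).
by have := pd_unitmx Mpd; rewrite -{1}SM unitmx_mul map_unitmx => /andP[].
Qed.

Lemma cmx_block m1 m2 n1 n2 (a : 'M[R]_(m1, n1)) (b : 'M[R]_(m1, n2))
    (c : 'M[R]_(m2, n1)) (d : 'M[R]_(m2, n2)) :
  cmx (block_mx a b c d) = block_mx (cmx a) (cmx b) (cmx c) (cmx d).
Proof. exact: map_block_mx. Qed.

Lemma cmxM m n q (a : 'M[R]_(m, n)) (b : 'M[R]_(n, q)) :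
  cmx (a *m b) = cmx a *m cmx b.
Proof. exact: map_mxM. Qed.

Lemma cmx0 m n : cmx (0 : 'M[R]_(m, n)) = 0.
Proof. exact: map_mx0. Qed.

Variables (n m p : nat).
Variables (A : 'M[R]_n) (B : 'M[R]_(n, m)) (Co : 'M[R]_(p, n)).
Implicit Types K : 'M[R]_(m + n, p + n).

(** Since [V] is definite, [x2 *m BK K = 0] for the policy component [x2] of [x].
    This decouples the plant component, which is then an uncontrollable mode of
    [(A, sqrtmx W)], hence zero; what remains is an uncontrollable mode of the
    policy. *)
Lemma closed_loop_controllable (W : 'M[R]_n) (V : 'M[R]_p) K lam
    (x : 'rV[C]_(n + n)) :
  pd V -> controllable A (sqrtmx W) -> controllable (AK K) (BK K) ->
  x *m cmx (Acl A B Co K) = lam *: x -> x *m cmx (Bcl W V K) = 0 -> x = 0.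
Proof.
move=> Vpd ctrlA ctrlK; rewrite -[x]hsubmxK !cmx_block !cmxM !cmx0.
move: (lsubmx x) (rsubmx x) => x1 x2.
rewrite !mul_row_block !mulmx0 addr0 add0r scale_row_mx -row_mx0.
move=> /eq_row_mx[x1A x2A] /eq_row_mx[x1W x2V].
have x2B : x2 *m cmx (BK K) = 0.
  by rewrite -[LHS](mulmxK (pd_sqrtmx_unit Vpd)) -(mulmxA x2) x2V mul0mx.
have x10 : x1 = 0.
  apply: (controllable_Hautus (lam := lam) ctrlA _ x1W).
  by rewrite -x1A [x2 *m _]mulmxA x2B mul0mx addr0.
rewrite x10; rewrite x10 mul0mx add0r in x2A.
by rewrite (controllable_Hautus ctrlK x2A x2B) row_mx0.
Qed.

Lemma closed_loop_observable (Q : 'M[R]_n) (Rw : 'M[R]_m) K lam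
    (x : 'cV[C]_(n + n)) :
  pd Rw -> observable (sqrtmx Q) A -> observable (CK K) (AK K) ->
  cmx (Acl A B Co K) *m x = lam *: x -> cmx (Ccl Q Rw K) *m x = 0 -> x = 0.
Proof.
move=> Rpd obsA obsK; rewrite -[x]vsubmxK !cmx_block !cmxM !cmx0.
move: (usubmx x) (dsubmx x) => x1 x2.
rewrite !mul_block_col !mul0mx addr0 add0r scale_col_mx -col_mx0.
move=> /eq_col_mx[x1A x2A] /eq_col_mx[x1Q x2R].
have x2C : cmx (CK K) *m x2 = 0.
  by rewrite -[LHS](mulKmx (pd_sqrtmx_unit Rpd)) (mulmxA _ _ x2) x2R mulmx0.
have x10 : x1 = 0.
  apply: (observable_Hautus (lam := lam) obsA _ x1Q).
  by rewrite -x1A -[_ *m x2]mulmxA x2C mulmx0 addr0.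
rewrite x10; rewrite x10 mulmx0 add0r in x2A.
by rewrite (observable_Hautus obsK x2A x2C) col_mx0.
Qed.

Lemma mxnrm_submx_le m1 m2 n1 n2 (M : 'M[C]_(m1 + m2, n1 + n2)) :
  [/\ mxnrm (ursubmx M) <= mxnrm M, mxnrm (dlsubmx M) <= mxnrm M &
      mxnrm (drsubmx M) <= mxnrm M].
Proof.
have := mxnrm_block (ulsubmx M) (ursubmx M) (dlsubmx M) (drsubmx M).
rewrite submxK => ->.
have := mxnrm_ge0 (ulsubmx M); have := mxnrm_ge0 (ursubmx M).
have := mxnrm_ge0 (dlsubmx M); have := mxnrm_ge0 (drsubmx M).
by split; lra.
Qed.

Lemma closed_loop_lipschitz (Q W : 'M[R]_n) (Rw : 'M[R]_m) (V : 'M[R]_p) :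
  exists2 l : R, 0 < l & forall K K',
  [/\ mxnrm (cmx (Acl A B Co K) - cmx (Acl A B Co K')) <=
        l * mxnrm (cmx K - cmx K'),
      mxnrm (cmx (Bcl W V K) - cmx (Bcl W V K')) <=
        l * mxnrm (cmx K - cmx K') &
      mxnrm (cmx (Ccl Q Rw K) - cmx (Ccl Q Rw K')) <=
        l * mxnrm (cmx K - cmx K')].
Proof.
have b0 := mxnrm_ge0 (cmx B); have c0 := mxnrm_ge0 (cmx Co).
have v0 := mxnrm_ge0 (cmx (sqrtmx V)); have r0 := mxnrm_ge0 (cmx (sqrtmx Rw)).
exists (1 + mxnrm (cmx B) + mxnrm (cmx Co) + mxnrm (cmx (sqrtmx V)) +
  mxnrm (cmx (sqrtmx Rw))); first by lra.
move=> K K'; set E := cmx K - cmx K'.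
have [ur dl dr] := mxnrm_submx_le E.
have E0 := mxnrm_ge0 E.
have nrm0 m1 m2 : mxnrm (0 : 'M[C]_(m1, m2)) = 0.
  by rewrite -(scale0r 0) mxnrmZ Normc.normc0 mul0r.
have EC : cmx (CK K) - cmx (CK K') = ursubmx E.
  by apply/matrixP => i j; rewrite !mxE.
have EB : cmx (BK K) - cmx (BK K') = dlsubmx E.
  by apply/matrixP => i j; rewrite !mxE.
have EA : cmx (AK K) - cmx (AK K') = drsubmx E.
  by apply/matrixP => i j; rewrite !mxE.
have BE := mxnrmM_le (lexx (mxnrm (cmx B))) ur.
have EC' := mxnrmM_le dl (lexx (mxnrm (cmx Co))).
have EV := mxnrmM_le dl (lexx (mxnrm (cmx (sqrtmx V)))).
have RE := mxnrmM_le (lexx (mxnrm (cmx (sqrtmx Rw)))) ur.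
split; rewrite !cmx_block opp_block_mx add_block_mx mxnrm_block !subrr !nrm0.
- rewrite EA !cmxM -mulmxBr -mulmxBl EC EB; nra.
- rewrite !cmxM -mulmxBl EB; nra.
- rewrite !cmxM -mulmxBr EC; nra.
Qed.

Lemma mxnrm_ball m1 m2 (X : 'M[R]_(m1, m2)) e : 0 < e ->
  exists2 d, 0 < d & forall Y, ball X d Y -> mxnrm (cmx Y - cmx X) < e.
Proof.
move=> e0; exists (e / (m1 * m2).+1%:R); first by rewrite divr_gt0.
move=> Y [_ XY]; rewrite mxnrmB.
apply: (@le_lt_trans _ _ ((m1 * m2)%:R * (e / (m1 * m2).+1%:R))).
  apply: mxnrm_le => i j; rewrite !mxE -rmorphB/= expr0n addr0 sqrtr_sqr.
  exact/ltW/XY.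
by rewrite mulrCA gtr_pMr// ltr_pdivrMr// mul1r ltr_nat.
Qed.

(** Both closures in the definition of the boundary are taken inside the
    policies, so a nearby policy that does not stabilize has an unstable closed
    loop. *)
Lemma boundary_imaginary_eigenvalue K :
  stabilizing_boundary A B Co K ->
  exists w, eigenvalue (cmx (Acl A B Co K)) (0 +i* w)%C.
Proof.
move=> [[_ clS] clU]; have [l l0 lip] := closed_loop_lipschitz 0 0 0 0.
have near (S : set 'M[R]_(m + n, p + n)) : closure S K -> forall e, 0 < e ->
    exists2 K', S K' & mxnrm (cmx (Acl A B Co K') - cmx (Acl A B Co K)) < e.
  move=> clK e e0; have [d d0 dK] := mxnrm_ball K (divr_gt0 e0 l0).
  have [K' [SK' KK']] := clK _ (nbhsx_ballx K _ d0).
  exists K' => //; have [le _ _] := lip K' K; apply: le_lt_trans le _.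
  by rewrite mulrC -ltr_pdivlMr// dK.
apply: imaginary_eigenvalue => e e0.
  by have [K' [_ st] K'e] := near _ clS _ e0; exists (Acl A B Co K').
have [K' [pK' nst] K'e] := near _ clU _ e0; exists (Acl A B Co K') => // st.
by apply: nst; split.
Qed.

End ClosedLoop.

Theorem theorem4p1 (R : realType) (n m p : nat)
    (n_gt0 : (0 < n)%N) (m_gt0 : (0 < m)%N) (p_gt0 : (0 < p)%N)
    (A : 'M[R]_n) (B : 'M[R]_(n, m)) (C : 'M[R]_(p, n))
    (Q W : 'M[R]_n) (Rw : 'M[R]_m) (V : 'M[R]_p)
    (Q_psd : psd Q) (W_psd : psd W) (Rw_pd : pd Rw) (V_pd : pd V)
    (ctrl_AB : controllable A B) (ctrl_AW : controllable A (sqrtmx W))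
    (obs_CA : observable C A) (obs_QA : observable (sqrtmx Q) A)
    (K : nat -> 'M[R]_(m + n, p + n)) (Koo : 'M[R]_(m + n, p + n))
    (K_stab : forall t, stabilizing A B C (K t))
    (K_cvg : K t @[t --> \oo] --> Koo)
    (Koo_bd : stabilizing_boundary A B C Koo)
    (Koo_ctrl : controllable (AK Koo) (BK Koo))
    (Koo_obs : observable (CK Koo) (AK Koo)) :
  JLQG A B C Q W Rw V (K t) @[t --> \oo] --> +oo%E.
Proof.
have [w0 eig] := boundary_imaginary_eigenvalue Koo_bd.
have [g g0 [d d0 gain]] := transfer_near_imaginary_pole eig
  (fun x => closed_loop_controllable V_pd ctrl_AW Koo_ctrl (x := x))
  (fun x => closed_loop_observable Rw_pd obs_QA Koo_obs (x := x)).
have [l l0 lip] := closed_loop_lipschitz A B C Q W Rw V.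
apply/cvgeyPge => M.
pose c := (2 * pi * (((n + m) * (n + p))%:R ^+ 2 + 1))^-1 * g ^+ 2 : R.
have c0 : 0 < c.
  apply: mulr_gt0; last exact: exprn_gt0.
  rewrite invr_gt0; apply: mulr_gt0; first by rewrite mulr_gt0// pi_gt0.
  by rewrite ltr_wpDl ?sqr_ge0.
have M0 : 0 < M ^+ 2 + 1 by rewrite ltr_wpDl ?sqr_ge0.
(* Small enough for the gain estimate and for [c / e] to exceed [M ^ 2]. *)
pose e := Num.min d (c / (M ^+ 2 + 1)).
have e0 : 0 < e by rewrite lt_min d0 divr_gt0.
have ed : e <= d by rewrite ge_min lexx.
have Mce : M ^+ 2 <= c / e.
  rewrite ler_pdivlMr// (@le_trans _ _ ((M ^+ 2 + 1) * e))//.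
    by rewrite ler_wpM2r ?lerDl// ltW.
  by rewrite mulrC -ler_pdivlMr// ge_min lexx orbT.
have [r r0 Kr] := mxnrm_ball Koo (divr_gt0 e0 l0).
have /cvg_ballP/(_ _ r0) := K_cvg.
apply: filterS => t /Kr Kt.
have near_e (v : R) : v <= l * mxnrm (cmx (K t) - cmx Koo) -> v <= e.
  by move=> /le_trans; apply; rewrite mulrC -ler_pdivlMr// ltW.
have [/near_e At /near_e Bt /near_e Ct] := lip (K t) Koo.
have [_ stab_t] := K_stab t.
apply: (@le_trans _ _ (sqrte (c / e)%:E)); last first.
  apply: (H2norm_ge (x := w0) e0 (ltW g0)) => w w0w we.
  exact: gain.
apply: (@le_trans _ _ (sqrte (M ^+ 2)%:E)).
  by rewrite /= sqrtr_sqr lee_fin ler_norm.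
by rewrite lee_sqrt lee_fin// (le_trans _ Mce) ?sqr_ge0.
Qed.
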